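(* Let $G=G(w,r)$ be a finite weighted rooted graph with weight $w\colon E(G)\to\mathbb{R}^+$ and root $r\in V(G)$. Then $G\in FPC$ if and only if the following conditions hold simultaneously. (i) The root $r$ is a dominating vertex of $G$ and the labeling $w^0\colon V(G)\to\mathbb{R}^+$, defined by $w^0(r):=0$ and $w^0(v):=w(\{r,v\})$ for $v\ne r$, is an injective function. (ii) The inequality $$2\max_{e\in E(C)}w(e)\le\sum_{e\in E(C)}w(e)$$ holds for every cycle $C\subseteq G$. (iii) If $C$ is a cycle in $G$ and the equality $$2\max_{e\in E(C)}w(e)=\sum_{e\in E(C)}w(e)$$ holds, then $V(C)$ is a clique in $G$.
   Context: All graphs are simple and loopless with nonempty vertex set; $\mathbb{R}^+=[0,\infty)$. A weighted rooted graph $G(w,r)$ is a graph $G$ with a weight $w\colon E(G)\to\mathbb{R}^+$ and a distinguished vertex $r$ (the root). A vertex $v$ is dominating if it is adjacent to every other vertex. A clique is a set of vertices any two distinct members of which are adjacent. A cycle in $G$ is a finite subgraph $C\subseteq G$ with $|V(C)|\ge3$ whose vertices can be numbered $v_1,\dots,v_n$ so that $\{v_i,v_j\}\in E(C)$ iff $|i-j|=1$ or $|i-j|=n-1$. Two weighted rooted graphs $G_1(w_1,r_1)$, $G_2(w_2,r_2)$ are isomorphic if there is a bijection $f\colon V(G_1)\to V(G_2)$ with $f(r_1)=r_2$, with $\{u,v\}\in E(G_1)\Leftrightarrow\{f(u),f(v)\}\in E(G_2)$ for all $u,v$, and with $w_2(\{f(u),f(v)\})=w_1(\{u,v\})$ for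 every $\{u,v\}\in E(G_1)$. A scaling sequence is a sequence $\tilde r=(r_n)_{n\in\mathbb{N}}$ of positive reals with $r_n\to\infty$. Let $(X,d)$ be an unbounded metric space and $p\in X$ (the choice of $p$ is immaterial). $Seq(X,\tilde r)$ is the set of sequences $\tilde x=(x_n)_{n\in\mathbb{N}}$ in $X$ with $d(x_n,p)\to\infty$ for which the finite limit $\lim_{n\to\infty}d(x_n,p)/r_n$ exists. Put $\tilde x\equiv\tilde y$ iff $\lim_{n\to\infty}d(x_n,y_n)/r_n=0$; this is an equivalence relation. The graph $G_{X,\tilde r}$ has the $\equiv$-classes of $Seq(X,\tilde r)$ as vertices, and distinct vertices $u,v$ are adjacent iff $\lim_{n\to\infty}d(x_n,y_n)/r_n$ exists for $\tilde x\in u,\tilde y\in v$; the weight is then $\rho_X(\{u,v\}):=\lim_{n\to\infty}d(x_n,y_n)/r_n$. The root is the vertex $\nu_0:=\{(z_n)\subset X:\ d(z_n,p)\to\infty,\ d(z_n,p)/r_n\to0\}$. This gives the weighted rooted cluster $G_{X,\tilde r}(\rho_X,\nu_0)$. $FPC$ is the class of all weighted rooted graphs $G(w,r)$ with $|V(G)|<\infty$ for which there exist an unbounded metric space $(X,d)$ and a scaling sequence $\tilde r$ such that $G(w,r)$ and $G_{X,\tilde r}(\rho_X,\nu_0)$ are isomorphic as weighted rooted graphs. *)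

(* Defs.v *)
From HB Require Import structures.
From mathcomp Require Import all_boot all_order all_algebra.
From mathcomp Require Import all_classical all_reals all_analysis.

Set Implicit Arguments.
Unset Strict Implicit.
Unset Printing Implicit Defensive.

Import Order.TTheory GRing.Theory Num.Theory.
Import numFieldNormedType.Exports.

Local Open Scope classical_set_scope.
Local Open Scope ring_scope.

(* The vertex set is a subset of an ambient type [A], so that subgraphs and
   graphs whose vertices are themselves sets are graphs without coercions.  An
   edge is an unordered pair, i.e. a set [set u; v]. *)
Record graph (A : Type) := Graph {
  vertices : set A ;
  edges : set (set A) }.

Definition is_graph (A : Type) (G : graph A) : Prop :=
  vertices G !=set0 /\
  forall e, edges G e -> exists u v,
    [/\ vertices G u, vertices G v, u <> v & e = [set u; v]].

Definition adjacent (A : Type) (G : graph A) (u v : A) : Prop :=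
  edges G [set u; v].

Definition subgraph (A : Type) (H G : graph A) : Prop :=
  [/\ is_graph H, vertices H `<=` vertices G & edges H `<=` edges G].

Definition dominating (A : Type) (G : graph A) (v : A) : Prop :=
  vertices G v /\ forall u, vertices G u -> u <> v -> adjacent G u v.

Definition clique (A : Type) (G : graph A) (K : set A) : Prop :=
  K `<=` vertices G /\ forall u v, K u -> K v -> u <> v -> adjacent G u v.

(* The vertices are numbered from 0 instead of 1. *)
Definition is_cycle (A : Type) (C : graph A) : Prop :=
  is_graph C /\
  exists n (v : 'I_n -> A),
    [/\ (3 <= n)%N, injective v, vertices C = range v
      & forall i j : 'I_n, adjacent C (v i) (v j) <->
          `|i%:Z - j%:Z| = 1 \/ `|i%:Z - j%:Z| = n%:Z - 1].

(* Only the values of [weight] on edges are meaningful. *)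
Record wrgraph (R : realType) (A : Type) := WRGraph {
  wr_graph :> graph A ;
  weight : set A -> R ;
  wr_root : A }.

Definition is_wrgraph (R : realType) (A : Type) (G : wrgraph R A) : Prop :=
  [/\ is_graph G, vertices G (wr_root G)
    & forall e, edges G e -> 0 <= weight G e].

Definition wr_isomorphic (R : realType) (A B : Type)
    (G1 : wrgraph R A) (G2 : wrgraph R B) : Prop :=
  exists f : A -> B,
    [/\ set_bij (vertices G1) (vertices G2) f,
        f (wr_root G1) = wr_root G2,
        forall u v, vertices G1 u -> vertices G1 v ->
          (adjacent G1 u v <-> adjacent G2 (f u) (f v))
      & forall u v, vertices G1 u -> vertices G1 v -> adjacent G1 u v ->
          weight G2 [set f u; f v] = weight G1 [set u; v]].

Definition root_label (R : realType) (A : Type) (G : wrgraph R A) (v : A) : R :=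
  if `[< v = wr_root G >] then 0 else weight G [set wr_root G; v].

Definition total_weight (R : realType) (A : Type) (w : set A -> R)
  (C : graph A) : R := \sum_(e \in edges C) w e.

(* The default value 0 is harmless, since weights are nonnegative on edges. *)
Definition max_weight (R : realType) (A : Type) (w : set A -> R)
  (C : graph A) : R := \big[Num.max/0]_(e \in edges C) w e.

Definition unbounded_metric (R : realType) (X : metricType R) : Prop :=
  forall M : R, exists x y : X, M < mdist x y.

Definition scaling_sequence (R : realType) (r : nat -> R) : Prop :=
  (forall n, 0 < r n) /\ r @ \oo --> +oo.

Section Cluster.
Variables (R : realType) (X : metricType R) (p : X) (r : nat -> R).

Definition Seq : set (nat -> X) :=
  [set x | (fun n => mdist (x n) p) @ \oo --> +oo /\
           cvgn (fun n => mdist (x n) p / r n)].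

Definition seq_equiv (x y : nat -> X) : Prop :=
  (fun n => mdist (x n) (y n) / r n) @ \oo --> (0 : R).

Definition seq_class (x : nat -> X) : set (nat -> X) :=
  [set y | Seq y /\ seq_equiv x y].

Definition cluster_vertices : set (set (nat -> X)) := seq_class @` Seq.

(* Whether the limit exists does not depend on the representatives. *)
Definition cluster_edges : set (set (set (nat -> X))) :=
  [set e | exists u v, [/\ cluster_vertices u, cluster_vertices v, u <> v,
     e = [set u; v] &
     forall x y, u x -> v y -> cvgn (fun n => mdist (x n) (y n) / r n)]].

(* The value of the limit does not depend on the representatives, so on an
   edge [xget] selects the unique element of the set. *)
Definition cluster_weight (e : set (set (nat -> X))) : R :=
  xget 0 [set l : R | exists u v x y, [/\ e = [set u; v], u x, v y &
    (fun n => mdist (x n) (y n) / r n) @ \oo --> l]].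

Definition cluster_root : set (nat -> X) :=
  [set z | (fun n => mdist (z n) p) @ \oo --> +oo /\
           (fun n => mdist (z n) p / r n) @ \oo --> (0 : R)].

Definition cluster : wrgraph R (set (nat -> X)) :=
  WRGraph (Graph cluster_vertices cluster_edges) cluster_weight cluster_root.

End Cluster.

Definition FPC (R : realType) (A : Type) (G : wrgraph R A) : Prop :=
  [/\ is_wrgraph G, finite_set (vertices G) &
    exists (X : metricType R) (p : X) (r : nat -> R),
      [/\ unbounded_metric X, scaling_sequence r &
          wr_isomorphic G (cluster p r)]].

(* Main.v *)
Require Import Defs.
From HB Require Import structures.
From mathcomp Require Import all_boot all_order all_algebra.
From mathcomp Require Import all_classical all_reals all_analysis.
From mathcomp Require Import zify ring lra.

Set Implicit Arguments.
Unset Strict Implicit.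
Unset Printing Implicit Defensive.

Import Order.TTheory GRing.Theory Num.Theory.
Import numFieldNormedType.Exports.
(* Again, so that [adjacent] and [cluster] denote the graph notions rather than
   their topological namesakes. *)
Import Defs.

Local Open Scope classical_set_scope.
Local Open Scope ring_scope.

(** Necessity.  Choose a sequence in every vertex of the cluster.  Edge weights
are limits of the rescaled distances, so the polygon inequality passes to the
limit and gives the cycle inequality; if it becomes an equality for a cycle, the
rescaled distance of any two vertices of the cycle is squeezed between two
expressions with the same limit, hence converges, hence they are adjacent
([chain_le], [chain_tight], [cycle_conditions]).  Every vertex is adjacent to
the root because distances to the root class and to the base point agree in the
limit.  If two distinct vertices had the same label, interleaving their
sequences in infinitely many ways would produce infinitely many vertices
([equal_labels_equiv]).

Sufficiency.  The cycle inequality says that the shortest-path metric of G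
restricts to the weight on edges.  The equality condition says that the vertices
of a path from a to c as long as an edge ac form a clique; so if ac is an edge
and ab or bc is not, then the triangle inequality at a, b, c is strict.  By
finiteness the slack is uniform, and multiplying all distances between
nonadjacent vertices by 1 - eps gives a second metric.  The two metrics agree
with the weight on the edges and differ on every pair of distinct nonadjacent
vertices ([two_metrics]).

Now hang on a half-line, at a point of abscissa s_n, a copy of the vertex set
rescaled by r_n, with the first metric for odd n and the second for even n, glued
at its root; take r_n = n!^2 and s_n = r_n / n, so that s_n / r_n tends to 0
while s_(n+1) / r_n tends to infinity.  A sequence x_n whose distance to the
base point is comparable to r_n must then be, up to o(r_n), a vertex of the n-th
copy, possibly its root; its limit ratio determines the vertex because the
labels are distinct and finite in number, so the vertices of the cluster are the
constant choices of a vertex in each copy ([Seq_constant]).  Their rescaled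
distances converge on the edges and oscillate between two values elsewhere. *)

(** * Cycles as closed polygons *)

Lemma set2_eq (T : Type) (a b c d : T) : [set a; b] = [set c; d] ->
  (a = c /\ b = d) \/ (a = d /\ b = c).
Proof.
move=> E.
have Ha : [set c; d] a by rewrite -E; left.
have Hb : [set c; d] b by rewrite -E; right.
have Hc : [set a; b] c by rewrite E; left.
have Hd : [set a; b] d by rewrite E; right.
by move: Ha Hb Hc Hd => [Ha|Ha] [Hb|Hb] [Hc|Hc] [Hd|Hd];
  first [left; split; congruence | right; split; congruence].
Qed.

Definition side (A : Type) (u : nat -> A) (i : nat) : set A := [set u i; u i.+1].

Section Polygon.
Variables (A : Type) (n : nat) (u : nat -> A).
Hypothesis n3 : (3 <= n)%N.
Hypothesis uI : {in `I_n &, injective u}.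
Hypothesis un0 : u n = u 0.

Let uE i j : (i < n)%N -> (j < n)%N -> u i = u j -> i = j.
Proof. by move=> ni nj; apply: uI; rewrite inE. Qed.

(** With at least three corners, no two sides of a closed polygon are the same
unordered pair; this is what turns sums over edges into sums over indices. *)
Lemma side_inj : set_inj `I_n (side u).
Proof.
move=> i j; rewrite !inE /side /= => ni nj E.
case: (set2_eq E) => {E} [[E _]|[]]; first exact: uE.
case: (ltngtP j.+1 n) nj => // [nj _|nj _].
  move=> /(uE ni nj) ij; rewrite ij.
  (* Now [u j.+2 = u j], possible only if [n <= 2]. *)
  case: (ltngtP j.+2 n) => [nj2 /(uE nj2 (ltnW nj))|nj2|nj2]; [lia|lia|].
  by rewrite nj2 un0 => /uE; lia.
rewrite nj un0 => /uE i0; have {}i0 : i = 0%N by apply: i0; lia.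
by rewrite i0 => /uE; lia.
Qed.

Lemma polygon_total (R : realType) (w : set A -> R) (C : graph A) :
  edges C = side u @` `I_n -> total_weight w C = \sum_(i < n) w (side u i).
Proof.
move=> EC; rewrite /total_weight EC.
rewrite (@reindex_fsbig _ _ _ _ _ (side u) `I_n); last first.
  by split=> //; exact: side_inj.
by rewrite -fsbig_ord.
Qed.

Definition polygon : graph A := Graph (u @` `I_n) (side u @` `I_n).

Lemma polygon_is_graph : is_graph polygon.
Proof.
split; first by exists (u 0), 0%N => //=; lia.
move=> e [i /= ni <-]; exists (u i), (u i.+1).
have [ni1|ni1] := ltnP i.+1 n.
  split=> //; [by exists i | by exists i.+1 |].
  by move=> /(uE ni ni1); lia.
have -> : i.+1 = n by lia.
rewrite un0; split=> //; [by exists i | by exists 0%N => //=; lia | |].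
  by move=> /uE; lia.
by rewrite /side -un0; congr [set _; u _]; lia.
Qed.

Lemma polygon_is_cycle : is_cycle polygon.
Proof.
split; first exact: polygon_is_graph.
exists n, (fun i : 'I_n => u i); split=> //.
- by move=> i j /(uE (ltn_ord i) (ltn_ord j)) /val_inj.
- apply/seteqP; split=> x /=.
    by move=> [i /= ni <-]; exists (Ordinal ni).
  by move=> [i _ <-]; exists i => //=.
move=> i j; have := ltn_ord i; have := ltn_ord j.
move: (nat_of_ord i) (nat_of_ord j) => {}i {}j nj ni.
rewrite /adjacent /=; split.
  move=> [t /= nt E]; move: (set2_eq E) => {E}.
  have [nt1|nt1] := ltnP t.+1 n.
    by move=> [] [/uE E1 /uE E2]; have {}E1 := E1 nt ltac:(assumption);
      have {}E2 := E2 nt1 ltac:(assumption); lia.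
  have -> : t.+1 = n by lia.
  rewrite un0.
  have n0 : (0 < n)%N by lia.
  by move=> [] [/uE E1 /uE E2]; have {}E1 := E1 nt ltac:(assumption);
      have {}E2 := E2 n0 ltac:(assumption); lia.
have S a b : b = a.+1 -> (a < n)%N ->
    (side u @` `I_n) [set u a; u b] /\ (side u @` `I_n) [set u b; u a].
  by move=> -> an; rewrite (setUC [set u a.+1]); split; exists a.
have Z a b : a = 0%N -> b = n.-1 ->
    (side u @` `I_n) [set u a; u b] /\ (side u @` `I_n) [set u b; u a].
  move=> -> ->; rewrite -un0; have <- : side u n.-1 = [set u n.-1; u n].
    by rewrite /side prednK //; lia.
  by rewrite setUC; split; exists n.-1 => //=; try lia; rewrite /side prednK //; lia.
move=> D.
have : j = i.+1 \/ i = j.+1 \/ (i = 0%N /\ j = n.-1) \/ (j = 0%N /\ i = n.-1).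
  by lia.
case=> [/S|[/S|[[] /Z E /E|[] /Z E /E]]]; last by case.
- by move=> /(_ ni) [].
- by move=> /(_ nj) [].
- by case.
Qed.

End Polygon.

(** Numbering the corners cyclically from one end of a given edge [e] makes [e]
the last side, so that removing it leaves the path of the first [n] sides. *)
Lemma cycle_unroll (A : Type) (C : graph A) (e : set A) :
  is_cycle C -> edges C e ->
  exists n (u : nat -> A),
    [/\ (2 <= n)%N, {in `I_n.+1 &, injective u}, u n.+1 = u 0,
        C = polygon n.+1 u & e = side u n].
Proof.
move=> [[_ CG] [[|N] [v [//= N3 vI VC adjC]]]].
have EC f : edges C f -> exists i : 'I_N.+1, f = [set v i; v (ordS i)].
  move=> Cf; have [x [y [Cx Cy _ fE]]] := CG f Cf.
  move: Cx Cy; rewrite VC => -[i _ ix] [j _ jy].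
  rewrite fE -ix -jy in Cf *.
  have := (adjC i j).1 Cf.
  have := ltn_ord i; have := ltn_ord j => jn iN D.
  have : j = ordS i \/ i = ordS j.
    have : (j = i.+1 :> nat) \/ (i = j.+1 :> nat) \/
       (i = 0%N :> nat /\ j = N :> nat) \/ (j = 0%N :> nat /\ i = N :> nat) by lia.
    case=> [E|[E|[[E1 E2]|[E1 E2]]]]; [left|right|right|left];
      apply: val_inj => /=; rewrite ?E1 ?E2 ?modnn //.
      by rewrite modn_small -?E.
    by rewrite modn_small -?E.
  by case=> ->; [exists i | exists j; rewrite setUC].
have CE (i : 'I_N.+1) : edges C [set v i; v (ordS i)].
  apply/adjC => /=; have := ltn_ord i => iN.
  have [i1|i1] := ltnP i.+1 N.+1; first by rewrite modn_small //; lia.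
  have -> : nat_of_ord i = N by lia.
  by rewrite modnn; lia.
move=> Ce; have [k ek] := EC e Ce.
(* Corner 0 is the end [v (ordS k)] of [e], and corner [N] its end [v k]. *)
pose u i := v (inord ((k + i.+1) %% N.+1)).
have uM i : ((k + i.+1) %% N.+1 < N.+1)%N by rewrite ltn_mod.
have uS i : side u i = [set v (inord ((k + i.+1) %% N.+1));
     v (ordS (inord ((k + i.+1) %% N.+1)))].
  rewrite /side /u; congr [set _; v _]; apply: val_inj => /=.
  by rewrite !inordK // -[in RHS](addn1 (_ %% _)) modnDml addn1 addnS.
have uP (i : 'I_N.+1) : exists2 j, `I_N.+1 j & inord ((k + j.+1) %% N.+1) = i.
  exists ((i + (N - k)) %% N.+1)%N => /=; first by rewrite ltn_mod.
  apply: val_inj; rewrite /= inordK //.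
  rewrite -addSnnS modnDmr.
  have -> : (k.+1 + (i + (N - k)) = i + N.+1)%N by have := ltn_ord k; lia.
  by rewrite modnDr modn_small.
exists N, u; split.
- by lia.
- move=> i j; rewrite !inE /= => iN jN /vI.
  move=> /(congr1 val) /=; rewrite !inordK // => /eqP.
  by rewrite eqn_modDl -(addn1 i) -(addn1 j) eqn_modDr !modn_small // => /eqP.
- have E : ((k + N.+2) %% N.+1 = (k + 1) %% N.+1)%N.
    by rewrite (_ : k + N.+2 = k + 1 + N.+1)%N ?modnDr //; lia.
  by rewrite /u E.
- case: C VC EC CE {CG adjC Ce} => V E /= VC EC CE; congr Graph.
  rewrite VC; apply/seteqP; split=> x /=.
    by move=> [i _ <-]; have [j jN <-] := uP i; exists j.
  by move=> [j _ <-]; exists (inord ((k + j.+1) %% N.+1)).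
  apply/seteqP; split=> f /=.
    move=> /EC [i ->]; have [j jN <-] := uP i; exists j => //.
  by move=> [j _ <-]; rewrite uS; exact: CE.
- rewrite uS ek; congr ([set v _; v (ordS _)]);
  by apply: val_inj; rewrite /= inordK // modnDr modn_small.
Qed.

Section MaxWeight.
Variables (R : realType) (A : Type) (w : set A -> R) (C : graph A).
Hypothesis Cfin : finite_set (edges C).

Lemma le_max_weight e : edges C e -> w e <= max_weight w C.
Proof.
move=> Ce; rewrite /max_weight; have [we|we0] := eqVneq (w e) 0.
  by rewrite we; apply: bigmax_ge_id.
apply: (le_bigmax_seq _ _ xpredT) => //.
rewrite in_finite_support; last exact: finite_setIl.
by rewrite inE; split=> //=; apply/eqP.
Qed.

Lemma max_weight_attained :
  edges C !=set0 -> (forall e, edges C e -> 0 <= w e) ->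
  exists2 e, edges C e & w e = max_weight w C.
Proof.
move=> [e0 Ce0] w0.
have : max_weight w C = 0 \/ exists2 e, edges C e & w e = max_weight w C.
  rewrite /max_weight; set s := finite_support _ _ _.
  have sC e : e \in s -> edges C e.
    by rewrite in_finite_support ?inE; [case | exact: finite_setIl].
  elim: s sC => [|e s IH] sC; first by left; rewrite big_nil.
  rewrite big_cons; have [le|le] := leP (w e) (\big[Num.max/0]_(j <- s) w j).
    by apply: IH => f fs; apply: sC; rewrite inE fs orbT.
  by right; exists e => //; apply: sC; rewrite mem_head.
case=> // M0; exists e0 => //; apply/eqP; rewrite eq_le le_max_weight //=.
by rewrite M0 w0.
Qed.

End MaxWeight.

(** * The cluster on representatives *)

Lemma cvg_close (R : realType) (f g h : nat -> R) (l : R) :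
  (\forall n \near \oo, `|f n - g n| <= h n) -> h @ \oo --> (0 : R) ->
  f @ \oo --> l -> g @ \oo --> l.
Proof.
move=> fgh h0 fl.
have d0 : (fun n => g n - f n) @ \oo --> (0 : R).
  apply: (@squeeze_cvgr _ _ _ _ (fun n => - h n) h) => //; last first.
    by rewrite -[X in _ --> X]oppr0; exact: cvgN.
  near=> n; rewrite -ler_norml distrC.
  by near: n.
have -> : g = (fun n => f n + (g n - f n)).
  by apply/funext => n; rewrite addrC subrK.
by rewrite -[X in _ --> X]addr0; exact: cvgD.
Unshelve. all: by end_near. Qed.

Section ClusterFacts.
Variables (R : realType) (X : metricType R) (p : X) (r : nat -> R).
Hypothesis r_gt0 : forall n, 0 < r n.
Implicit Types x y z : nat -> X.

Definition scaled (x y : nat -> X) (n : nat) : R := mdist (x n) (y n) / r n.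

Lemma scaled_ge0 x y n : 0 <= scaled x y n.
Proof. by rewrite divr_ge0 ?mdist_ge0 ?ltW. Qed.

Lemma scaled_sym x y : scaled x y = scaled y x.
Proof. by apply/funext => n; rewrite /scaled metric_sym. Qed.

Lemma scaled_tri y x z n : scaled x z n <= scaled x y n + scaled y z n.
Proof.
by rewrite /scaled -mulrDl ler_pM2r ?invr_gt0 // metric_triangle.
Qed.

Lemma scaled_quad x x' y y' n :
  `|scaled x y n - scaled x' y' n| <= scaled x x' n + scaled y y' n.
Proof.
have := scaled_tri x' x y n; have := scaled_tri y' x' y n.
have := scaled_tri x x' y' n; have := scaled_tri y x y' n.
rewrite (scaled_sym x' x) (scaled_sym y' y) ler_norml => *.
by apply/andP; split; lra.
Qed.

(** Independence of the representatives: the weights and the adjacency of the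
cluster may be computed on any choice of sequences. *)
Lemma scaled_equiv x x' y y' (l : R) : seq_equiv r x x' -> seq_equiv r y y' ->
  scaled x y @ \oo --> l -> scaled x' y' @ \oo --> l.
Proof.
move=> xx' yy'.
apply: (@cvg_close _ _ _ (fun n => scaled x x' n + scaled y y' n)).
  by apply: nearW => n; exact: scaled_quad.
by rewrite -[X in _ --> X]addr0; exact: cvgD.
Qed.

Lemma seq_equiv_refl x : seq_equiv r x x.
Proof.
rewrite /seq_equiv (_ : (fun _ => _) = cst 0); first exact: cvg_cst.
by apply/funext => n; rewrite mdistxx mul0r.
Qed.

Lemma seq_equiv_sym x y : seq_equiv r x y -> seq_equiv r y x.
Proof. by rewrite /seq_equiv -!/(scaled _ _) scaled_sym. Qed.

Lemma seq_equiv_trans y x z :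
  seq_equiv r x y -> seq_equiv r y z -> seq_equiv r x z.
Proof.
by move=> xy yz; exact: scaled_equiv (seq_equiv_refl x) yz xy.
Qed.

Lemma seq_classP x y : Seq p r y ->
  seq_class p r x = seq_class p r y <-> seq_equiv r x y.
Proof.
move=> Sy; split=> [E|xy].
  have : seq_class p r y y by split=> //; exact: seq_equiv_refl.
  by rewrite -E => -[].
apply/seteqP; split=> z [Sz h]; split=> //.
  by apply: seq_equiv_trans h; exact: seq_equiv_sym.
exact: seq_equiv_trans h.
Qed.

Lemma cluster_edgesP x y : Seq p r x -> Seq p r y ->
  cluster_edges p r [set seq_class p r x; seq_class p r y] <->
  ~ seq_equiv r x y /\ cvgn (scaled x y).
Proof.
move=> Sx Sy; have xx : seq_class p r x x by split=> //; exact: seq_equiv_refl.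
have yy : seq_class p r y y by split=> //; exact: seq_equiv_refl.
split.
  move=> [u [v [_ _ uv E C]]].
  suff : seq_class p r x <> seq_class p r y /\ cvgn (scaled x y).
    by case=> nxy cxy; split=> // /(seq_classP x Sy).
  case: (set2_eq E) => -[Eu Ev]; subst u v.
    by split=> //; exact: C.
  by split; [exact: nesym | rewrite scaled_sym; exact: C].
move=> [nxy cxy]; exists (seq_class p r x), (seq_class p r y); split=> //.
- by exists x.
- by exists y.
- by move=> /(seq_classP x Sy).
move=> x' y' [_ xx'] [_ yy'].
by apply/cvg_ex; move/cvg_ex: cxy => [l h]; exists l; exact: scaled_equiv h.
Qed.

Lemma cluster_weightE x y (l : R) : Seq p r x -> Seq p r y ->
  scaled x y @ \oo --> l ->
  cluster_weight r [set seq_class p r x; seq_class p r y] = l.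
Proof.
move=> Sx Sy xyl; apply: xget_unique.
  exists (seq_class p r x), (seq_class p r y), x, y; split=> //;
  by split=> //; exact: seq_equiv_refl.
move=> l' [u [v [x' [y' [E ux' vy' h]]]]].
have : scaled x' y' @ \oo --> l.
  case: (set2_eq E) ux' vy' => -[<- <-] [_ h1] [_ h2].
    exact: scaled_equiv xyl.
  by rewrite scaled_sym; exact: scaled_equiv xyl.
by apply: cvg_unique.
Qed.

Lemma seq_class_root z : cluster_root p r z ->
  Seq p r z /\ seq_class p r z = cluster_root p r.
Proof.
move=> [zoo z0]; split; first by split=> //; apply/cvg_ex; exists 0.
have pp := seq_equiv_refl (fun=> p).
apply/seteqP; split=> y.
  move=> [[yoo _] zy]; split=> //.
  exact: (scaled_equiv zy pp z0).
move=> [yoo y0]; split; first by split=> //; apply/cvg_ex; exists 0.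
apply: (@seq_equiv_trans (fun=> p)) => //.
exact: seq_equiv_sym.
Qed.

End ClusterFacts.

(** * Necessity: limits of rescaled distances *)

Section Necessity.
Variables (R : realType) (X : metricType R) (p : X) (r : nat -> R).
Hypothesis r_gt0 : forall n, 0 < r n.
Local Notation scaled := (scaled r).

Lemma frequently_subseq (P : nat -> Prop) :
  (forall N, exists2 n, (N <= n)%N & P n) ->
  exists phi : nat -> nat, [/\ injective phi, forall i, (i <= phi i)%N &
    forall i, P (phi i)].
Proof.
move=> h.
have /choice[g gP] : forall N, exists n, (N <= n)%N /\ P n.
  by move=> N; have [n] := h N; exists n.
pose phi := fix phi i := if i is j.+1 then g (phi j).+1 else g 0%N.
have phiS i : (phi i < phi i.+1)%N by have [] := gP (phi i).+1.
have phi_mono : {homo phi : i j / (i < j)%N}.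
  by apply: homo_ltn => //; exact: ltn_trans.
exists phi; split.
- by apply: incn_inj; apply: leq_mono.
- by elim=> // i; have := phiS i; lia.
- by case=> [|i] /=; [case: (gP 0%N) | case: (gP (phi i).+1)].
Qed.

(** If the rescaled distance of [x] and [y] stays above [eps] along a subsequence
[phi], split its indices into infinitely many infinite classes and replace [x]
by [y] on one class at a time.  The mixed sequences keep the common ratio [c],
and are pairwise inequivalent. *)
Lemma equal_labels_equiv x y (c : R) : finite_set (cluster_vertices p r) ->
  Seq p r x -> Seq p r y ->
  scaled x (fun=> p) @ \oo --> c -> scaled y (fun=> p) @ \oo --> c ->
  seq_equiv r x y.
Proof.
move=> Vfin Sx Sy xc yc; apply: contrapT => nxy.
have [eps eps0 epsP] : exists2 eps : R, 0 < eps &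
    forall N, exists2 n, (N <= n)%N & eps <= scaled x y n.
  apply: contrapT => h; apply: nxy; apply/cvgrPdist_lt => eps eps0.
  apply: contrapT => h2; apply: h; exists eps => // N.
  apply: contrapT => h3; apply: h2; exists N => // n /= Nn.
  rewrite sub0r normrN ger0_norm; last exact: scaled_ge0.
  by rewrite ltNge; apply/negP => h4; apply: h3; exists n.
have [phi [phiI phi_ge phiP]] := frequently_subseq epsP.
(* Class [k] consists of the indices [phi i] with 2-adic valuation of [i] equal
   to [k]; [2 ^ k * (2 * N).+1] is a member beyond [N]. *)
pose S k n := exists2 i, phi i = n & logn 2 i = k.
pose mix k n := if `[< S k n >] then y n else x n.
have mixP k (Q : nat -> X -> Prop) : (\forall n \near \oo, Q n (x n)) ->
    (\forall n \near \oo, Q n (y n)) -> \forall n \near \oo, Q n (mix k n).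
  by move=> Qx Qy; near=> n; rewrite /mix; case: ifP => _; near: n.
have mixS k : Seq p r (mix k).
  case: Sx Sy => [/cvgryPge xoo _] [/cvgryPge yoo _]; split.
    by apply/cvgryPge => M; apply: (mixP k (fun n z => M <= mdist z p)).
  apply/cvg_ex; exists c; apply/cvgrPdist_lt => e e0.
  move/cvgrPdist_lt: xc => /(_ e e0) xc; move/cvgrPdist_lt: yc => /(_ e e0) yc.
  by apply: (mixP k (fun n z => `|c - mdist z p / r n| < e)).
have mix_inj k k' : k <> k' -> ~ seq_equiv r (mix k) (mix k').
  move=> kk' /cvgrPdist_lt /(_ eps eps0) [N _ /= h].
  pose i := (2 ^ k * (2 * N).+1)%N.
  have ik : logn 2 i = k.
    rewrite lognM ?expn_gt0 // lognX logn_prime // eqxx muln1.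
    by rewrite logn_coprime ?addn0 // coprime2n /= oddM.
  have Ni : (N <= phi i)%N.
    apply: leq_trans (phi_ge i); rewrite /i.
    by have : (0 < 2 ^ k)%N by [rewrite expn_gt0]; nia.
  have := h _ Ni; rewrite sub0r normrN ger0_norm ?divr_ge0 ?mdist_ge0 ?ltW //.
  rewrite /mix asboolT; last by exists i.
  rewrite asboolF; last by move=> [j /phiI -> jk]; apply: kk'; rewrite -jk.
  by rewrite metric_sym => /(le_lt_trans (phiP i)); rewrite ltxx.
apply: infinite_nat.
have -> : [set: nat] = (fun k => seq_class p r (mix k)) @^-1` cluster_vertices p r.
  by apply/seteqP; split=> // k _; exists (mix k).
apply: finite_preimage => // k k' _ _ /(seq_classP r_gt0 _ (mixS k')) h.
by apply: contrapT => /mix_inj.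
Unshelve. all: by end_near. Qed.

Lemma scaled_chain (z : nat -> nat -> X) i j n : (i <= j)%N ->
  scaled (z i) (z j) n <= \sum_(i <= t < j) scaled (z t) (z t.+1) n.
Proof.
elim: j => [|j IH]; first by rewrite leqn0 => /eqP ->;
  rewrite big_geq // /scaled mdistxx mul0r.
rewrite leq_eqVlt => /orP[/eqP ->|ij].
  by rewrite big_geq // /scaled mdistxx mul0r.
rewrite big_nat_recr //=; apply: le_trans (scaled_tri r_gt0 (z j) _ _ _) _.
by rewrite lerD2r IH.
Qed.

Lemma chain_sum_cvg (z : nat -> nat -> X) (wt : nat -> R) m :
  (forall i, (i < m)%N -> scaled (z i) (z i.+1) @ \oo --> wt i) ->
  forall i j, (j <= m)%N ->
  (fun n => \sum_(i <= t < j) scaled (z t) (z t.+1) n) @ \oo -->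
    \sum_(i <= t < j) wt t.
Proof.
move=> h i; elim=> [|j IH] jm.
  rewrite big_geq // (_ : (fun _ => _) = cst 0); first exact: cvg_cst.
  by apply/funext => n; rewrite big_geq.
have [ij|ij] := leqP i j; last first.
  rewrite big_geq // (_ : (fun _ => _) = cst 0); first exact: cvg_cst.
  by apply/funext => n; rewrite big_geq.
rewrite big_nat_recr //=.
rewrite (_ : (fun _ => _) = (fun n => \sum_(i <= t < j) scaled (z t) (z t.+1) n
   + scaled (z j) (z j.+1) n)); last first.
  by apply/funext => n; rewrite big_nat_recr.
by apply: cvgD; [apply: IH; exact: ltnW | exact: h].
Qed.

Lemma chain_le (z : nat -> nat -> X) (wt : nat -> R) m (L : R) :
  (forall i, (i < m)%N -> scaled (z i) (z i.+1) @ \oo --> wt i) ->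
  scaled (z 0%N) (z m) @ \oo --> L -> L <= \sum_(i < m) wt i.
Proof.
move=> h hL; have := chain_sum_cvg h (i := 0%N) (leqnn m); rewrite big_mkord => hS.
apply: (ler_cvg_to hL hS); apply: nearW => n.
exact: scaled_chain.
Qed.

(** In a degenerate polygon, the upper bound on the distance of [z i] and [z j]
by the sides between them and the lower bound by [L] minus the other sides have
the same limit. *)
Lemma chain_tight (z : nat -> nat -> X) (wt : nat -> R) m (L : R) :
  (forall i, (i < m)%N -> scaled (z i) (z i.+1) @ \oo --> wt i) ->
  scaled (z 0%N) (z m) @ \oo --> L -> L = \sum_(i < m) wt i ->
  forall i j, (i <= j)%N -> (j <= m)%N -> cvgn (scaled (z i) (z j)).
Proof.
move=> h hL EL i j ij jm; apply/cvg_ex; exists (\sum_(i <= t < j) wt t).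
have im : (i <= m)%N by exact: leq_trans jm.
have hS a b := @chain_sum_cvg _ _ _ h a b.
apply: (@squeeze_cvgr _ _ _ _
  (fun n => scaled (z 0%N) (z m) n
     - \sum_(0 <= t < i) scaled (z t) (z t.+1) n
     - \sum_(j <= t < m) scaled (z t) (z t.+1) n)
  (fun n => \sum_(i <= t < j) scaled (z t) (z t.+1) n)).
- apply: nearW => n; rewrite scaled_chain // andbT.
  have := scaled_tri r_gt0 (z i) (z 0%N) (z m) n.
  have := scaled_tri r_gt0 (z j) (z i) (z m) n.
  have := scaled_chain z n (leq0n i); have := scaled_chain z n jm.
  by lra.
- have -> : \sum_(i <= t < j) wt t =
      L - \sum_(0 <= t < i) wt t - \sum_(j <= t < m) wt t.
    rewrite EL -(big_mkord xpredT) [in RHS](big_cat_nat (leq0n i) im) /=.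
    by rewrite [in RHS](big_cat_nat ij jm) /=; lra.
  by apply: cvgB; [apply: cvgB => //; exact: hS | exact: hS].
- exact: hS.
Qed.

End Necessity.

Lemma subgraph_edges_finite (A : Type) (C G : graph A) :
  finite_set (vertices G) -> subgraph C G -> finite_set (edges C).
Proof.
move=> Gfin [[_ CE] VC _].
pose f (q : A * A) := [set q.1; q.2].
apply: (@sub_finite_set _ _ (f @` (vertices G `*` vertices G))).
  move=> e /CE [u [v [Cu Cv _ ->]]]; exists (u, v) => //.
  by split; exact: VC.
by apply: finite_image; exact: finite_setX.
Qed.

Lemma cycle_has_edge (A : Type) (C : graph A) : is_cycle C -> edges C !=set0.
Proof.
move=> [_ [n [v [n3 _ _ adj]]]].
have n0 : (0 < n)%N by lia.
have n1 : (1 < n)%N by lia.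
exists [set v (Ordinal n0); v (Ordinal n1)]; apply/adj.
by left.
Qed.

Lemma edge_vertices (A : Type) (G : graph A) u v : is_graph G ->
  adjacent G u v -> [/\ vertices G u, vertices G v & u <> v].
Proof.
move=> [_ GE] /GE [a [b [Ga Gb ab E]]].
by case: (set2_eq E) => -[-> ->]; split=> //; exact: nesym.
Qed.

Section Forward.
Variables (R : realType) (A : Type) (G : wrgraph R A).
Variables (X : metricType R) (p : X) (r : nat -> R).
Hypothesis Gwr : is_wrgraph G.
Hypothesis Gfin : finite_set (vertices G).
Hypothesis r_gt0 : forall n, 0 < r n.
Hypothesis iso : wr_isomorphic G (cluster p r).
Local Notation scaled := (scaled r).

Let Ggraph : is_graph G. Proof. by case: Gwr. Qed.

Lemma cluster_representatives : exists x : A -> nat -> X,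
  [/\ forall a, vertices G a -> Seq p r (x a),
      forall a b, adjacent G a b ->
        scaled (x a) (x b) @ \oo --> weight G [set a; b],
      forall a b, vertices G a -> vertices G b -> a <> b ->
        cvgn (scaled (x a) (x b)) -> adjacent G a b,
      forall a b, vertices G a -> vertices G b ->
        seq_equiv r (x a) (x b) -> a = b &
      scaled (x (wr_root G)) (fun=> p) @ \oo --> (0 : R)].
Proof.
have [f [[/= fV fI _] froot fE fw]] := iso.
have /choice[x xP] : forall a, exists x, vertices G a ->
    Seq p r x /\ seq_class p r x = f a.
  move=> a; have [Va|nVa] := pselect (vertices G a); last by exists (fun=> p).
  by have [x Sx fx] := fV _ Va; exists x.
have eqI a b : vertices G a -> vertices G b ->
    seq_equiv r (x a) (x b) -> a = b.
  move=> Va Vb; have [Sa fa] := xP a Va; have [Sb fb] := xP b Vb.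
  by move=> /(seq_classP r_gt0 _ Sb); rewrite fa fb; apply: fI; rewrite inE.
exists x; split=> //.
- by move=> a /xP [].
- move=> a b ab; have [Va Vb _] := edge_vertices Ggraph ab.
  have [Sa fa] := xP a Va; have [Sb fb] := xP b Vb.
  have /(fE _ _ Va Vb) := ab.
  rewrite /adjacent /= -fa -fb => /(cluster_edgesP r_gt0 Sa Sb) [_ cab].
  rewrite -(fw a b Va Vb ab) /= -fa -fb.
  by rewrite (cluster_weightE r_gt0 Sa Sb cab).
- move=> a b Va Vb ab cab.
  have [Sa fa] := xP a Va; have [Sb fb] := xP b Vb.
  apply/(fE _ _ Va Vb); rewrite /adjacent /= -fa -fb.
  by apply/(cluster_edgesP r_gt0 Sa Sb); split=> // /(eqI _ _ Va Vb).
- have Vr : vertices G (wr_root G) by case: Gwr.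
  have [Sr] := xP _ Vr; rewrite froot /= => E.
  have : seq_class p r (x (wr_root G)) (x (wr_root G)).
    by split=> //; exact: seq_equiv_refl.
  by rewrite E => -[].
Qed.

Lemma cluster_finite : finite_set (cluster_vertices p r).
Proof.
have [f [[/= _ _ fS] _ _ _]] := iso.
by apply: sub_finite_set fS _; exact: finite_image.
Qed.

Lemma root_dominating_injective :
  dominating G (wr_root G) /\ set_inj (vertices G) (root_label G).
Proof.
have [x [xS xadj xcvg xI xroot]] := cluster_representatives.
have Vr : vertices G (wr_root G) by case: Gwr.
have toroot a : vertices G a -> scaled (x a) (x (wr_root G)) @ \oo -->
    lim (scaled (x a) (fun=> p) @ \oo).
  move=> Va; apply: (scaled_equiv r_gt0 (seq_equiv_refl r _)).
    exact/seq_equiv_sym/xroot.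
  by have [_] := xS a Va.
have dom a : vertices G a -> a <> wr_root G -> adjacent G a (wr_root G).
  move=> Va ar; apply: xcvg => //; apply/cvg_ex.
  by eexists; exact: toroot.
split; first by split.
have label a : vertices G a ->
    scaled (x a) (fun=> p) @ \oo --> root_label G a.
  move=> Va; rewrite /root_label; case: asboolP => [->//|ar].
  have := xadj _ _ (dom _ Va ar); rewrite setUC.
  apply: (scaled_equiv r_gt0 (seq_equiv_refl r _)).
  exact: xroot.
move=> a b; rewrite !inE => Va Vb E; apply: xI => //.
apply: (equal_labels_equiv r_gt0 cluster_finite (xS _ Va) (xS _ Vb) (label _ Va)).
by rewrite E; exact: label.
Qed.

Lemma cycle_conditions (C : graph A) : subgraph C G -> is_cycle C ->
  2 * max_weight (weight G) C <= total_weight (weight G) C /\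
  (2 * max_weight (weight G) C = total_weight (weight G) C ->
   clique G (vertices C)).
Proof.
move=> CG Ccyc; have [_ VC EC] := CG.
have [x [xS xadj xcvg xI xroot]] := cluster_representatives.
have w_ge0 e : edges C e -> 0 <= weight G e.
  by move=> /EC; case: Gwr => _ _; apply.
have [e Ce <-] := max_weight_attained (subgraph_edges_finite Gfin CG)
  (cycle_has_edge Ccyc) w_ge0.
have [n [u [n2 uI un0 EC' Ee]]] := cycle_unroll Ccyc Ce.
have sideG i : (i <= n)%N -> adjacent G (u i) (u i.+1).
  by move=> ni; apply: EC; rewrite EC'; exists i.
have uV i : (i <= n)%N -> vertices G (u i).
  by move=> ni; apply: VC; rewrite EC'; exists i.
have n3 : (3 <= n.+1)%N by [].
have EC2 : edges C = side u @` `I_n.+1 by rewrite EC'.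
rewrite (polygon_total n3 uI un0 _ EC2).
rewrite big_ord_recr /= -Ee.
pose z i := x (u i); pose wt i := weight G (side u i).
have zwt i : (i < n)%N -> scaled (z i) (z i.+1) @ \oo --> wt i.
  by move=> ni; apply/xadj/sideG/ltnW.
have zL : scaled (z 0%N) (z n) @ \oo --> weight G e.
  rewrite scaled_sym Ee /z -un0; apply: xadj; exact: sideG.
have := chain_le r_gt0 zwt zL; rewrite -/wt => le.
split; first by rewrite -/(wt _); lra.
move=> E; have {}E : weight G e = \sum_(i < n) wt i by rewrite /wt; lra.
(* Convergence along the unrolled cycle gives adjacency of its corners. *)
have tight := chain_tight r_gt0 zwt zL E.
split; first exact: VC.
have adj i j : (i <= j)%N -> (j <= n)%N -> u i <> u j -> adjacent G (u i) (u j).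
  by move=> ij jn uij; apply: xcvg => //;
    [exact/uV/(leq_trans ij) | exact: uV | exact: tight].
move=> a b; rewrite EC' => -[i /= ni <-] [j /= nj <-] uij.
have [ij|/ltnW ji] := leqP i j; first exact: adj.
by rewrite /adjacent setUC; apply: adj => //; exact: nesym.
Qed.

End Forward.

(** * Two metrics extending the weight of a finite graph *)

Definition metric_axioms (R : realType) (X : Type) (d : X -> X -> R) :=
  [/\ forall x, d x x = 0, forall x y, d x y = 0 -> x = y,
      forall x y, d x y = d y x & forall y x z, d x z <= d x y + d y z].

Lemma metric_ge0 (R : realType) (X : Type) (d : X -> X -> R) :
  metric_axioms d -> forall x y, 0 <= d x y.
Proof.
by move=> [d0 _ ds dt] x y; have := dt y x x; rewrite d0 (ds y x); lra.
Qed.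

Definition path_length (R : realType) (T : Type) (w : T -> T -> R) x p : R :=
  \sum_(a <- pairmap w x p) a.

(** Cycles are presented as paths without repeated vertices closed by one edge, so
that the hypotheses on cycles apply directly to shortened paths. *)
Section Metrization.
Variables (R : realType) (T : finType) (e : rel T) (w : T -> T -> R).
Local Notation len := (path_length w).

Hypothesis e_sym : symmetric e.
Hypothesis e_irr : irreflexive e.
Hypothesis w_sym : forall u v, w u v = w v u.
Hypothesis w_gt0 : forall u v, e u v -> 0 < w u v.
Hypothesis e_conn : forall u v, exists2 p, path e u p & last u p = v.
Hypothesis polygon_le : forall x p, path e x p -> uniq (x :: p) ->
  (2 <= size p)%N -> e (last x p) x -> w x (last x p) <= len x p.
Hypothesis polygon_eq : forall x p, path e x p -> uniq (x :: p) ->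
  (2 <= size p)%N -> e (last x p) x -> w x (last x p) = len x p ->
  {in x :: p &, forall u v, u != v -> e u v}.

Let len_nil x : len x [::] = 0.
Proof. by rewrite /path_length big_nil. Qed.

Let len_cons x y p : len x (y :: p) = w x y + len y p.
Proof. by rewrite /path_length big_cons. Qed.

Let len_cat x p q : len x (p ++ q) = len x p + len (last x p) q.
Proof. by rewrite /path_length pairmap_cat big_cat. Qed.

Let len_ge0 x p : path e x p -> 0 <= len x p.
Proof.
elim: p x => [|y p IH] x /=; first by rewrite len_nil.
by move=> /andP[/w_gt0 /ltW xy /IH yp]; rewrite len_cons addr_ge0.
Qed.

Let len_rev x p : len (last x p) (rev (belast x p)) = len x p.
Proof.
elim: p x => [|y p IH] x //=.
rewrite rev_cons -cats1 len_cat IH !len_cons len_nil addr0 addrC w_sym.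
by case: p {IH} => [|z p] //=; rewrite rev_cons last_rcons.
Qed.

(** Cutting a loop off a path strictly shortens it, because weights are
positive: a path of minimal length has distinct vertices. *)
Lemma shorten_lt x p : path e x p -> exists q,
  [/\ path e x q, last x q = last x p, uniq (x :: q) &
      q = p \/ len x q < len x p].
Proof.
elim: p x => [|y p IH] x /=; first by exists [::]; split=> //; left.
move=> /andP[exy /IH [q [yq lq uq cq]]].
have lqp : len y q <= len y p by case: cq => [->|/ltW].
have [xyq|xyq] := boolP (x \in y :: q); last first.
  exists (y :: q); split=> //=; [by rewrite exy | by rewrite xyq |].
  by case: cq => [->|cq]; [left | right; rewrite !len_cons ltrD2l].
move: xyq; rewrite inE; case/orP => [/eqP xy|xq].
  by rewrite xy e_irr in exy.
case/splitPr: {cq} q / xq yq lq uq lqp => q1 q2.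
rewrite cat_path /= last_cat /= => /and3P[yq1 lx xq2] lq.
rewrite cat_uniq => /andP[_ /and3P[_ _ uq2]] lqp.
exists q2; split=> //; right; rewrite len_cons.
apply: lt_le_trans (_ : w x y + len y (q1 ++ x :: q2) <= _); last first.
  by rewrite lerD2l.
rewrite len_cat len_cons.
by have := w_gt0 exy; have := w_gt0 lx; have := len_ge0 yq1; lra.
Qed.

(** Only the finitely many paths without repeated vertices compete, so that the
minimal length is attained. *)
Lemma geodesic_exists x y : exists p, [/\ path e x p, last x p = y,
  uniq (x :: p) & forall q, path e x q -> last x q = y -> len x p <= len x q].
Proof.
have [p0 xp0 lp0] := e_conn x y.
have [q0 [xq0 lq0 uq0 _]] := shorten_lt xp0.
have bsz (q : seq T) : uniq q -> (size q <= #|T|)%N.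
  by move=> uq; rewrite -(card_uniqP uq) max_card.
pose P (q : {bseq #|T| of T}) :=
  [&& path e x q, last x q == y & uniq (x :: q)].
have Pb q (h : (size q <= #|T|)%N) : P (Bseq h) =
  [&& path e x q, last x q == y & uniq (x :: q)] by [].
have uq0' : uniq q0 by case/andP: uq0.
have P0 : P (Bseq (bsz _ uq0')) by rewrite Pb xq0 uq0 lq0 lp0 eqxx.
case: (@arg_minP _ _ _ _ P (fun q => len x q) P0) => m /and3P[xm /eqP lm um].
move=> mmin; exists m; split=> // q xq lq.
have [q' [xq' lq' uq' cq']] := shorten_lt xq.
have uq1 : uniq q' by case/andP: uq'.
apply: le_trans (mmin (Bseq (bsz _ uq1)) _) _.
  by rewrite Pb xq' uq' lq' lq eqxx.
by case: cq' => [E|/ltW //]; rewrite -[X in _ <= len x X]E.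
Qed.

Let geo x y := projT1 (cid (geodesic_exists x y)).

Definition geodist x y := len x (geo x y).

Let geoP x y : [/\ path e x (geo x y), last x (geo x y) = y,
  uniq (x :: geo x y) &
  forall q, path e x q -> last x q = y -> geodist x y <= len x q].
Proof. by rewrite /geodist /geo; case: cid. Qed.

Lemma geodist_metric : metric_axioms geodist.
Proof.
have ge0 x y : 0 <= geodist x y by case: (geoP x y) => /len_ge0.
split.
- move=> x; apply/eqP; rewrite eq_le ge0 andbT.
  by rewrite -(len_nil x); case: (geoP x x) => _ _ _; apply.
- move=> x y; rewrite /geodist; case: (geoP x y).
  case: (geo x y) => [|z p] //= /andP[/w_gt0 xz /len_ge0 zp] _ _ _.
  by rewrite len_cons => E; exfalso; lra.
- suff le x y : geodist x y <= geodist y x.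
    by move=> x y; apply/eqP; rewrite eq_le !le.
  case: (geoP x y) => _ _ _ h; case: (geoP y x) => yp lp _ _.
  rewrite /geodist -(len_rev y) lp; apply: h.
    rewrite -[x in path _ x]lp rev_path.
    by rewrite (eq_path (e' := e)) // => a b; rewrite e_sym.
  case: (geo y x) lp => [|z p] //=.
  by rewrite rev_cons last_rcons.
- move=> y x z; case: (geoP x y) => xp lp _ _; case: (geoP y z) => yq lq _ _.
  case: (geoP x z) => _ _ _; rewrite {2 3}/geodist -{2}lp -len_cat; apply.
    by rewrite cat_path xp lp.
  by rewrite last_cat lp.
Qed.

Lemma geodist_edge x y : e x y -> geodist x y = w x y.
Proof.
move=> exy; apply/eqP; rewrite eq_le; apply/andP; split.
  have -> : w x y = len x [:: y] by rewrite len_cons len_nil addr0.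
  by case: (geoP x y) => _ _ _; apply; rewrite //= exy.
rewrite /geodist; case: (geoP x y) => xp lp up _.
rewrite -{1}lp; case: (ltnP 1 (size (geo x y))) => sp.
  by apply: polygon_le => //; rewrite lp e_sym.
case: (geo x y) sp xp lp up => [|z [|]] //=; last first.
  by rewrite len_cons len_nil addr0.
by move=> _ _ xy; rewrite xy e_irr in exy.
Qed.

(** Geodesics from [a] to [b] and from [b] to [c] combine into a path as long as
the edge [ac]; being minimal it repeats no vertex, and together with [ac] it is
a cycle with equality, whose vertices form a clique. *)
Lemma geodist_between a b c : e a c -> b != a -> b != c ->
  geodist a c = geodist a b + geodist b c -> e a b && e b c.
Proof.
move=> eac ba bc E.
case: (geoP a b) => ap lp _ _; case: (geoP b c) => bq lq _ _.
set p := geo a b in ap lp; set q := geo b c in bq lq.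
have apq : path e a (p ++ q) by rewrite cat_path ap lp.
have lpq : last a (p ++ q) = c by rewrite last_cat lp.
have Epq : len a (p ++ q) = geodist a c by rewrite len_cat lp E.
have [s [as_ ls us [s_pq|]]] := shorten_lt apq; last first.
  rewrite Epq; case: (geoP a c) => _ _ _ /(_ s as_).
  by rewrite ls lpq => /(_ erefl); case: ltgtP.
have bs : b \in s.
  rewrite s_pq mem_cat; apply/orP; left.
  by case: (p) lp ba => [|z p1] /=; [move=> <-; rewrite eqxx | move=> <-; rewrite mem_last].
have cs : c \in s.
  rewrite s_pq mem_cat; apply/orP; right.
  by case: (q) lq bc => [|z q1] /=; [move=> <-; rewrite eqxx | move=> <-; rewrite mem_last].
have s2 : (1 < size s)%N.
  by case: (s) bs cs bc => [|z [|]] //=; rewrite !inE => /eqP -> /eqP ->; rewrite eqxx.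
have h : {in a :: s &, forall u v, u != v -> e u v}.
  apply: polygon_eq => //; first by rewrite ls lpq e_sym.
  by rewrite ls lpq -(geodist_edge eac) -Epq s_pq.
by rewrite !h ?inE ?eqxx ?bs ?cs ?orbT // eq_sym.
Qed.

(** Finitely many strict triangle inequalities are given by [geodist_between]; the
least of their relative slacks, capped by 1/2, works for all. *)
Lemma uniform_slack : exists2 eps : R, 0 < eps < 1 & forall a b c,
  e a c -> b != a -> b != c -> ~~ (e a b && e b c) ->
  geodist a c <= (1 - eps) * (geodist a b + geodist b c).
Proof.
have [_ d_eq0 _ dt] := geodist_metric.
have ge0 := metric_ge0 geodist_metric.
pose bad (t : T * T * T) := let: (a, b, c) := t in
  [&& e a c, b != a, b != c & ~~ (e a b && e b c)].
pose slack (t : T * T * T) := let: (a, b, c) := t in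
  1 - geodist a c / (geodist a b + geodist b c).
exists (\big[Order.min/2^-1]_(t | bad t) slack t).
  apply/andP; split; last first.
    by apply: le_lt_trans (bigmin_le_id _ _ _ _) _; lra.
  apply: lt_bigmin => [|[[a b] c] /and4P[eac ba bc nab]]; first by lra.
  rewrite /slack subr_gt0.
  have S0 : 0 < geodist a b + geodist b c.
    apply: ltr_wpDr => //; rewrite lt_def ge0 andbT.
    by apply: contraNN ba => /eqP /d_eq0 ->.
  rewrite ltr_pdivrMr // mul1r lt_def dt andbT.
  by apply: contraNN nab => /eqP E; apply: geodist_between.
move=> a b c eac ba bc nab.
have S0 : 0 < geodist a b + geodist b c.
  apply: ltr_wpDr => //; rewrite lt_def ge0 andbT.
  by apply: contraNN ba => /eqP /d_eq0 ->.
rewrite -ler_pdivrMr // lerBrDr -lerBrDl.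
by apply: (@bigmin_le_cond _ _ _ _ (a, b, c) bad slack); rewrite /bad eac ba bc nab.
Qed.

(** The second metric shrinks the first by the factor [1 - eps] on nonadjacent
pairs only.  The triangle inequality can fail only for an edge [ac] and a
third vertex [b] that is not adjacent to both ends, and there the slack absorbs
the shrinking; this is why the shrinking is proportional to the distance. *)
Lemma two_metrics : exists d1 d2 : T -> T -> R,
  [/\ metric_axioms d1, metric_axioms d2,
      forall u v, e u v -> d1 u v = w u v /\ d2 u v = w u v &
      forall u v, u != v -> ~~ e u v -> d1 u v != d2 u v].
Proof.
have [d_xx d_eq0 d_sym d_tri] := geodist_metric.
have d_ge0 := metric_ge0 geodist_metric.
have [eps /andP[eps0 eps1] slack] := uniform_slack.
pose d2 u v := if (u == v) || e u v then geodist u v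
               else (1 - eps) * geodist u v.
have d2_le u v : (1 - eps) * geodist u v <= d2 u v.
  rewrite /d2; case: ifP => _ //; have := d_ge0 u v.
  by move=> h; apply: ler_piMl => //; lra.
exists geodist, d2; split.
- exact: geodist_metric.
- split.
  + by move=> x; rewrite /d2 eqxx d_xx.
  + move=> x y; rewrite /d2; case: ifP => _; first exact: d_eq0.
    move=> /eqP; rewrite mulf_eq0 subr_eq0 => /orP[/eqP|/eqP /d_eq0 //].
    by move=> E; rewrite -E ltxx in eps1.
  + by move=> x y; rewrite /d2 eq_sym e_sym d_sym.
  + move=> b a c; have [<-|ba] := eqVneq b a.
      by rewrite {2}/d2 eqxx d_xx add0r.
    have [<-|bc] := eqVneq b c.
      by rewrite {3}/d2 eqxx d_xx addr0.
    have D2 : (1 - eps) * (geodist a b + geodist b c) <= d2 a b + d2 b c.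
      by rewrite mulrDr lerD.
    have [E|ac] := eqVneq a c.
      rewrite -E in D2 *; rewrite {1}/d2 eqxx d_xx; apply: le_trans D2.
      by apply: mulr_ge0; [lra | exact: addr_ge0].
    rewrite {1}/d2 (negPf ac) /=; case: ifPn => eac; last first.
      by apply: le_trans D2; apply: ler_wpM2l => //; lra.
    have [/andP[eab ebc]|nab] := boolP (e a b && e b c).
      by rewrite /d2 eab ebc !orbT.
    by apply: le_trans D2; apply: slack.
- by move=> u v euv; rewrite /d2 euv orbT geodist_edge.
- move=> u v uv nuv; rewrite /d2 (negPf uv) (negPf nuv) /=.
  rewrite mulrBl mul1r eq_sym subr_eq -[X in X == _]addr0.
  rewrite (inj_eq (addrI _)) eq_sym mulf_eq0 gt_eqF //=.
  by apply: contraNN uv => /eqP /d_eq0 ->.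
Qed.

End Metrization.

(** * Rescaled copies along a half-line *)

Lemma cvg_invn (R : realType) (c : R) :
  (fun n => c * n%:R^-1) @ \oo --> (0 : R).
Proof.
rewrite -[X in _ --> X](mulr0 c); apply: cvgMr.
apply/cvgrPdist_lt => e e0; near=> n.
rewrite sub0r normrN ger0_norm ?invr_ge0 //.
have ne : e^-1 < n%:R by near: n; exact: nbhs_infty_gtr.
have n0 : 0 < n%:R :> R by apply: lt_trans ne; rewrite invr_gt0.
by rewrite invf_plt ?posrE.
Unshelve. all: by end_near. Qed.

Lemma cvg_finite_eventually (R : realType) (T : finType) (g : T -> R)
    (v : nat -> T) (c : R) :
  (fun n => g (v n)) @ \oo --> c -> \forall n \near \oo, g (v n) = c.
Proof.
move=> /cvgrPdist_lt gc.
pose delta := \big[Order.min/1]_(t | g t != c) `|c - g t|.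
have delta0 : 0 < delta.
  by apply: lt_bigmin => // t gt; rewrite normr_gt0 subr_eq0 eq_sym.
near=> n; apply/eqP; apply: contraT => gn.
have : `|c - g (v n)| < delta by near: n; exact: gc.
by rewrite ltNge /delta bigmin_le_cond.
Unshelve. all: by end_near. Qed.

(** A distance bundled with its axioms, so that the carrier type [metric_space]
that depends on it can receive a canonical metric structure. *)
Record metric_on (R : realType) (X : Type) := MetricOn {
  metric_fun :> X -> X -> R ;
  metric_onP : metric_axioms metric_fun }.

Definition metric_space (R : realType) (X : Type) (d : metric_on R X) : Type := X.

Section MetricSpace.
Variables (R : realType) (X : choiceType) (d : metric_on R X).

Let d_xx x : d x x = 0. Proof. by case: (metric_onP d). Qed.
Let d_eq0 x y : d x y = 0 -> x = y.
Proof. by case: (metric_onP d) => _ h _ _; apply: h. Qed.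
Let d_sym x y : d x y = d y x.
Proof. by case: (metric_onP d) => _ _ h _; apply: h. Qed.
Let d_tri y x z : d x z <= d x y + d y z.
Proof. by case: (metric_onP d) => _ _ _ h; apply: h. Qed.

HB.instance Definition _ := Choice.copy (metric_space d) X.
HB.instance Definition _ :=
  isMetric.Build R (metric_space d) d_xx d_eq0 d_sym d_tri.

End MetricSpace.

Section Scales.
Variable R : realType.

(** Copy [n] of the vertex set is magnified by [scale n] and placed at abscissa
[post n].  As [scale 0 / 0 = 0], the first copy sits at the origin.  The
quotients [post n / scale n = 1 / n] and [post n.+1 / scale n = n.+1] separate
the scales in both directions. *)
Definition scale n : R := n`!%:R ^+ 2.

Definition post n : R := scale n / n%:R.

Lemma scale_gt0 n : 0 < scale n.
Proof. by rewrite exprn_gt0 // ltr0n fact_gt0. Qed.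

Lemma scaleS n : scale n.+1 = n.+1%:R ^+ 2 * scale n.
Proof. by rewrite /scale factS natrM exprMn. Qed.

Lemma scale_ge1 n : 1 <= scale n.
Proof. by rewrite exprn_ege1 // ler1n fact_gt0. Qed.

Lemma scale_mono : {homo scale : m n / (m <= n)%N >-> m <= n}.
Proof.
apply: homo_leq => // [|n]; first exact: le_trans.
rewrite scaleS ler_peMl ?(ltW (scale_gt0 _)) //.
by rewrite exprn_ege1 // ler1n.
Qed.

Lemma scale_lt k n : (k < n)%N -> scale k * n%:R <= scale n.
Proof.
case: n => // n; rewrite ltnS => /scale_mono kn; rewrite scaleS.
have n1 : 1 <= n.+1%:R :> R by rewrite ler1n.
have := scale_gt0 k; nra.
Qed.

Lemma post0 : post 0 = 0.
Proof. by rewrite /post invr0 mulr0. Qed.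

Lemma postS n : post n.+1 = n.+1%:R * scale n.
Proof.
rewrite /post scaleS; move: (scale n) => s.
by rewrite expr2 -!mulrA; congr (_ * _); rewrite mulrC divfK ?pnatr_eq0.
Qed.

Lemma post_ge0 n : 0 <= post n.
Proof. by rewrite divr_ge0 // ltW // scale_gt0. Qed.

Lemma post_le_scale n : post n <= scale n.
Proof.
case: n => [|n]; first by rewrite post0 ltW ?scale_gt0.
by rewrite postS mulrC; exact: scale_lt.
Qed.

Lemma post_div n : post n / scale n = n%:R^-1.
Proof. by rewrite /post mulrAC mulfV ?mul1r // gt_eqF // scale_gt0. Qed.

Lemma post_ltS n : post n < post n.+1.
Proof.
case: n => [|n]; first by rewrite post0 postS mul1r scale_gt0.
apply: le_lt_trans (post_le_scale _) _; rewrite postS.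
by rewrite ltr_pMl ?scale_gt0 // ltr1n.
Qed.

Lemma post_mono : {mono post : m n / (m <= n)%N >-> m <= n}.
Proof.
apply: le_mono; apply: homo_ltn; [exact: lt_trans | exact: post_ltS].
Qed.

Lemma post_inj : injective post.
Proof.
by move=> m n E; apply/eqP; rewrite eqn_leq -!post_mono E lexx.
Qed.

Lemma le_post n : n%:R <= post n.
Proof.
case: n => [|n]; first by rewrite post0.
by rewrite postS ler_peMr // scale_ge1.
Qed.

End Scales.

(** The distances to the root must be the same in all copies, because they give
the limit ratios to the base point; the other distances may vary with [n]. *)
Section Model.
Variables (R : realType) (T : finType) (r0 : T).
Variables (d : nat -> T -> T -> R) (w0 : T -> R).
Hypothesis d_metric : forall n, metric_axioms (d n).
Hypothesis d_root : forall n t, d n t r0 = w0 t.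
Hypothesis w0_inj : injective w0.
Local Notation scale := (scale R).
Local Notation post := (post R).

(** Points of different copies are joined through the roots of these copies and
the half-line. *)
Definition blowup_dist (x y : nat * T) : R :=
  if x.1 == y.1 then scale x.1 * d x.1 x.2 y.2
  else scale x.1 * w0 x.2 + `|post x.1 - post y.1| + scale y.1 * w0 y.2.

Let d_ge0 n := metric_ge0 (d_metric n).

Let w0_ge0 t : 0 <= w0 t. Proof. by rewrite -(d_root 0). Qed.

Let w0_root : w0 r0 = 0.
Proof. by rewrite -(d_root 0); case: (d_metric 0). Qed.

Let sw_ge0 n t : 0 <= scale n * w0 t.
Proof. by rewrite mulr_ge0 // ltW // scale_gt0. Qed.

Lemma blowup_metric : metric_axioms blowup_dist.
Proof.
split.
- move=> x; rewrite /blowup_dist eqxx.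
  by case: (d_metric x.1) => -> _ _ _; rewrite mulr0.
- move=> [n u] [m v]; rewrite /blowup_dist /=; case: eqP => [-> |nm].
    move=> /eqP; rewrite mulf_eq0 gt_eqF ?scale_gt0 //= => /eqP.
    by case: (d_metric m) => _ h _ _ /h ->.
  have := sw_ge0 n u; have := sw_ge0 m v.
  have : 0 < `|post n - post m|.
    by rewrite normr_gt0 subr_eq0; apply/eqP => /post_inj.
  by move=> *; exfalso; clear nm; lra.
- move=> [n u] [m v]; rewrite /blowup_dist /= eq_sym; case: eqP => [->|_].
    by case: (d_metric n) => _ _ -> _.
  by rewrite distrC; lra.
- move=> [m v] [n u] [k t]; rewrite /blowup_dist /=.
  have hu := sw_ge0 n u; have hv := sw_ge0 m v; have ht := sw_ge0 k t.
  have tri i a b c : scale i * d i a c <= scale i * d i a b + scale i * d i b c.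
    rewrite -mulrDr ler_wpM2l ?(ltW (scale_gt0 _ _)) //.
    by case: (d_metric i) => _ _ _; apply.
  have ds i a b : d i a b = d i b a by case: (d_metric i).
  have rt i a b : scale i * d i a b <= scale i * w0 a + scale i * w0 b.
    by have := tri i a r0 b; rewrite (ds i r0) !d_root.
  have rr i a b : scale i * w0 a <= scale i * d i a b + scale i * w0 b.
    by have := tri i a b r0; rewrite !d_root.
  have pp := ler_distD (post m) (post n) (post k).
  have nn i j := normr_ge0 (post i - post j).
  case: (eqVneq n k) => [E|nk]; case: (eqVneq n m) => [E'|nm];
    case: (eqVneq m k) => [E''|mk] /=.
  + by subst; apply: tri.
  + by rewrite -E' E eqxx in mk.
  + by rewrite E E'' eqxx in nm.
  + by subst k; have := rt n u t; have := nn n m; have := nn m n; lra.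
  + by rewrite E' E'' eqxx in nk.
  + by subst m; have := rr n u v; lra.
  + by subst m; have := rr k t v; rewrite (ds k t); lra.
  + by lra.
Qed.

Definition blowup : metricType R := metric_space (MetricOn blowup_metric).

Definition basepoint : blowup := (0%N, r0).
Definition constant_at (t : T) : nat -> blowup := fun n => (n, t).

Local Notation scaled := (@scaled R blowup scale).

Lemma blowup_distE (x y : blowup) : mdist x y = blowup_dist x y.
Proof. by []. Qed.

Lemma dist_base (x : blowup) :
  mdist x basepoint = scale x.1 * w0 x.2 + post x.1.
Proof.
rewrite blowup_distE /blowup_dist /=; case: eqP => [->|_].
  by rewrite d_root post0 addr0.
by rewrite w0_root mulr0 addr0 post0 subr0 ger0_norm ?post_ge0.
Qed.

Lemma scaled_constant t t' n :
  scaled (constant_at t) (constant_at t') n = d n t t'.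
Proof.
rewrite /scaled blowup_distE /blowup_dist /= eqxx mulrAC mulfV ?mul1r //.
by rewrite gt_eqF // scale_gt0.
Qed.

Lemma scaled_constant_base t :
  scaled (constant_at t) (fun=> basepoint) @ \oo --> w0 t.
Proof.
rewrite (_ : scaled _ _ = fun n => w0 t + 1 * n%:R^-1).
  rewrite -[X in _ --> X]addr0; apply: cvgD; first exact: cvg_cst.
  exact: cvg_invn.
apply/funext => n; rewrite /scaled dist_base mulrDl post_div mul1r.
by rewrite mulrAC mulfV ?mul1r // gt_eqF // scale_gt0.
Qed.

Lemma dist_base_ge (x : blowup) : x.1%:R <= mdist x basepoint.
Proof.
by rewrite dist_base; have := sw_ge0 x.1 x.2; have := le_post R x.1; lra.
Qed.

Lemma constant_Seq t : Seq basepoint scale (constant_at t).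
Proof.
split; last by apply/cvg_ex; exists (w0 t); exact: scaled_constant_base.
apply/cvgryPge => M; near=> n.
apply: le_trans (dist_base_ge _) => /=.
by near: n; exact: nbhs_infty_ger.
Unshelve. all: by end_near. Qed.

Lemma blowup_unbounded : unbounded_metric blowup.
Proof.
move=> M; have [N _ /(_ N (leqnn N)) MN] := nbhs_infty_gtr M.
exists ((N, r0) : blowup), basepoint.
by apply: lt_le_trans (dist_base_ge _); exact: MN.
Qed.

Lemma scale_scaling : scaling_sequence scale.
Proof.
split; first exact: scale_gt0.
apply/cvgryPge => M; near=> n.
apply: le_trans (post_le_scale R n); apply: le_trans (le_post R n).
by near: n; exact: nbhs_infty_ger.
Unshelve. all: by end_near. Qed.

(** If [x n] lies in copy [k n], boundedness of the ratio forces [k n <= n], and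
a copy with [k n < n] is negligible at scale [n], so that [x n] may be replaced
by the root of copy [n].  The labels of the resulting vertices [v n] converge;
as they take finitely many distinct values, [v] is eventually constant. *)
Lemma Seq_constant (x : nat -> blowup) : Seq basepoint scale x ->
  exists t, seq_equiv scale x (constant_at t).
Proof.
move=> [_ /cvg_ex[c hc]].
pose W := \sum_t w0 t.
have leW t : w0 t <= W.
  by rewrite /W (bigD1 t) //= lerDl sumr_ge0.
have W0 : 0 <= W by apply: sumr_ge0.
have W1 : 0 <= W + 1 by rewrite addr_ge0.
pose v n := if (x n).1 == n then (x n).2 else r0.
have kn : \forall n \near \oo, ((x n).1 <= n)%N.
  move/cvgrPdist_lt: hc => /(_ 1 ltr01) hc.
  near=> n; rewrite leqNgt; apply/negP => nk.
  have h1 : `|c - mdist (x n) basepoint / scale n| < 1 by near: n.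
  have h2 : c + 1 < n.+1%:R.
    have : c + 1 < n%:R by near: n; exact: nbhs_infty_gtr.
    by rewrite -[n.+1]addn1 natrD; lra.
  have h3 : n.+1%:R <= mdist (x n) basepoint / scale n.
    rewrite ler_pdivlMr ?scale_gt0 // -postS dist_base.
    have : post n.+1 <= post (x n).1 by rewrite post_mono.
    by have := sw_ge0 (x n).1 (x n).2; lra.
  by move: h1; rewrite ltr_norml; lra.
have small n a : 0 <= a -> ((x n).1 < n)%N ->
    scale (x n).1 * a / scale n <= a * n%:R^-1.
  move=> a0 kn'; have n0 : 0 < n%:R :> R by rewrite ltr0n (leq_trans _ kn').
  rewrite ler_pdivrMr ?scale_gt0 // [_ * a]mulrC -mulrA ler_wpM2l //.
  by rewrite mulrC ler_pdivlMr //; exact: scale_lt.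
have vc : (fun n => w0 (v n)) @ \oo --> c.
  apply: (cvg_close _ (cvg_invn (W + 1)) hc); near=> n.
  have kn' : ((x n).1 <= n)%N by near: n.
  have in0 : 0 <= n%:R^-1 :> R by rewrite invr_ge0.
  rewrite dist_base /v; case: eqP => [E|nE].
    rewrite E mulrDl post_div mulrAC mulfV ?mul1r ?gt_eqF ?scale_gt0 //.
    by rewrite addrAC subrr add0r ger0_norm // ler_peMl // lerDr.
  have lt_kn : ((x n).1 < n)%N by lia.
  rewrite w0_root subr0 ger0_norm.
    apply: le_trans (small _ _ W1 lt_kn); rewrite ler_pM2r ?invr_gt0 ?scale_gt0 //.
    rewrite mulrDr mulr1 lerD ?post_le_scale // ler_wpM2l //.
    exact/ltW/scale_gt0.
  apply: divr_ge0; last exact/ltW/scale_gt0.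
  by apply: addr_ge0; [exact: sw_ge0 | exact: post_ge0].
have vE := cvg_finite_eventually vc.
have [N _ /(_ N (leqnn N)) vN] := vE.
exists (v N).
rewrite /seq_equiv -/(scaled x (constant_at (v N))).
apply: (@squeeze_cvgr _ _ _ _ (fun=> 0) (fun n => (W + 1) * n%:R^-1));
  [|exact: cvg_cst|exact: cvg_invn].
near=> n; rewrite scaled_ge0 /=; last exact: scale_gt0.
have kn' : ((x n).1 <= n)%N by near: n.
have vn : v n = v N.
  by apply: w0_inj; rewrite vN; near: n.
rewrite /scaled blowup_distE /blowup_dist /=; move: vn; rewrite {1}/v.
case: eqP => [E <-|nE <-].
  case: (d_metric (x n).1) => -> _ _ _; rewrite mulr0 mul0r.
  by rewrite mulr_ge0 ?addr_ge0 ?invr_ge0.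
have lt_kn : ((x n).1 < n)%N by lia.
rewrite w0_root mulr0 addr0 distrC ger0_norm ?subr_ge0 ?post_mono //.
apply: le_trans (_ : scale (x n).1 * W / scale n + post n / scale n <= _).
  rewrite -mulrDl ler_pM2r ?invr_gt0 ?scale_gt0 // lerD //.
    by rewrite ler_wpM2l // ltW // scale_gt0.
  by rewrite lerBlDr lerDl post_ge0.
by rewrite post_div mulrDl mul1r lerD // small.
Unshelve. all: by end_near. Qed.

Lemma constant_equiv_inj t t' :
  seq_equiv scale (constant_at t) (constant_at t') -> t = t'.
Proof.
move=> h; apply: w0_inj; apply/eqP; rewrite -subr_eq0 -normr_le0.
apply: (ler_cvg_to (cvg_cst _) h); apply: nearW => n /=.
rewrite -/(scaled _ _ n) scaled_constant ler_norml.
case: (d_metric n) => _ _ ds dt.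
have := dt t t' r0; have := dt t' t r0; rewrite (ds t' t) !d_root.
by move=> *; apply/andP; split; lra.
Qed.

Lemma constant_root : cluster_root basepoint scale (constant_at r0).
Proof.
split; first by case: (constant_Seq r0).
by rewrite -[X in _ --> X]w0_root; exact: scaled_constant_base.
Qed.

End Model.

(** * Sufficiency and the equivalence *)

Lemma cvg_alternating (R : realType) (a b : R) :
  cvgn (fun n => if odd n then a else b) -> a = b.
Proof.
move=> /cvg_ex[l /cvgrPdist_lt h]; apply/eqP; apply: contraT => ab.
have ab0 : 0 < `|a - b| / 2 by rewrite divr_gt0 // normr_gt0 subr_eq0.
have [N _ hN] := h _ ab0.
have := hN N.*2.+1; have := hN N.*2; rewrite /= odd_double /=.
have N2 : (N <= N.*2)%N by lia.
move=> /(_ N2) h1 /(_ (leqW N2)) h2.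
have := ler_normB (l - b) (l - a).
by rewrite (_ : l - b - (l - a) = a - b); lra.
Qed.

Section Backward.
Variables (R : realType) (A : Type) (G : wrgraph R A).
Hypothesis Gwr : is_wrgraph G.
Hypothesis Gfin : finite_set (vertices G).
Hypothesis root_dom : dominating G (wr_root G).
Hypothesis label_inj : set_inj (vertices G) (root_label G).
Hypothesis cycle_le : forall C : graph A, subgraph C G -> is_cycle C ->
  2 * max_weight (weight G) C <= total_weight (weight G) C.
Hypothesis cycle_eq : forall C : graph A, subgraph C G -> is_cycle C ->
  2 * max_weight (weight G) C = total_weight (weight G) C ->
  clique G (vertices C).

Variables (T : finType) (g : T -> A) (r0 : T).
Hypothesis g_inj : injective g.
Hypothesis g_range : vertices G = range g.
Hypothesis g_root : g r0 = wr_root G.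

Let Ggraph : is_graph G. Proof. by case: Gwr. Qed.

Let e (u v : T) := `[< adjacent G (g u) (g v) >].
Let w (u v : T) := weight G [set g u; g v].
Local Notation len := (path_length w).

Let Vg t : vertices G (g t). Proof. by rewrite g_range; exists t. Qed.

Let e_sym : symmetric e.
Proof. by move=> u v; rewrite /e /adjacent setUC. Qed.

Let e_irr : irreflexive e.
Proof. by move=> u; apply/asboolP => /(edge_vertices Ggraph) [_ _]; apply. Qed.

Let w_sym u v : w u v = w v u. Proof. by rewrite /w setUC. Qed.

Let w_ge0 u v : e u v -> 0 <= w u v.
Proof. by move=> /asboolP; case: Gwr => _ _; apply. Qed.

Let e_root t : t != r0 -> e t r0.
Proof.
move=> tr; apply/asboolP; rewrite g_root; apply: root_dom.2 => //.
by rewrite -g_root => /g_inj/eqP; rewrite (negPf tr).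
Qed.

Let e_conn u v : exists2 p, path e u p & last u p = v.
Proof.
have [->|vr] := eqVneq v r0.
  have [->|ur] := eqVneq u r0; first by exists [::].
  by exists [:: r0]; rewrite //= e_root.
have rv : e r0 v by rewrite e_sym e_root.
have [->|ur] := eqVneq u r0; first by exists [:: v]; rewrite //= rv.
by exists [:: r0; v]; rewrite //= rv e_root.
Qed.

Lemma path_length_nth x p : len x p =
  \sum_(i < size p) w (nth x (x :: p) i) (nth x (x :: p) i.+1).
Proof.
rewrite /path_length (big_nth 0) size_pairmap big_mkord.
by apply: eq_bigr => i _; rewrite (nth_pairmap x).
Qed.

Lemma cycle_of_path x p : path e x p -> uniq (x :: p) -> (2 <= size p)%N ->
  e (last x p) x -> exists C : graph A,
  [/\ subgraph C G, is_cycle C, vertices C = g @` [set` x :: p],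
      edges C [set g x; g (last x p)] &
      total_weight (weight G) C = len x p + w x (last x p)].
Proof.
move=> xp up sp lx; pose u i := g (nth x (x :: p) i).
pose n := (size p).+1.
have n3 : (3 <= n)%N by [].
have uI : {in `I_n &, injective u}.
  move=> i j; rewrite !inE => ni nj /g_inj/eqP.
  by rewrite nth_uniq // => /eqP.
have un0 : u n = u 0%N by rewrite /u nth_default.
have lastE : last x p = nth x (x :: p) (size p) by rewrite (last_nth x).
have sideE : side u (size p) = [set g x; g (last x p)].
  by rewrite /side un0 setUC /u -lastE.
have sideG i : (i < n)%N -> edges G (side u i).
  rewrite ltnS leq_eqVlt => /orP[/eqP ->|ip].
    by rewrite sideE setUC; move/asboolP: lx.
  by move/(pathP x): xp => /(_ i ip) /asboolP.
exists (polygon n u); split.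
- split; [exact: polygon_is_graph | |].
    by move=> _ [i _ <-]; exact: Vg.
  by move=> _ [i ni <-]; exact: sideG.
- exact: polygon_is_cycle.
- apply/seteqP; split=> a [] /=.
    by move=> i ni <-; exists (nth x (x :: p) i) => //=; exact: mem_nth.
  move=> t tp <-; exists (index t (x :: p)); first by rewrite -index_mem in tp.
  by rewrite /u nth_index.
- by exists (size p) => //=.
- have EC : edges (polygon n u) = side u @` `I_n by [].
  rewrite (polygon_total n3 uI un0 _ EC) big_ord_recr /= sideE.
  by rewrite path_length_nth.
Qed.

Let closing_le_max (C : graph A) f : subgraph C G -> edges C f ->
  weight G f <= max_weight (weight G) C.
Proof.
by move=> CG; apply: le_max_weight; exact: subgraph_edges_finite CG.
Qed.

Let polygon_le x p : path e x p -> uniq (x :: p) -> (2 <= size p)%N ->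
  e (last x p) x -> w x (last x p) <= len x p.
Proof.
move=> xp up sp lx; have [C [CG Cc _ Ce E]] := cycle_of_path xp up sp lx.
have := cycle_le CG Cc; have := closing_le_max CG Ce; rewrite E -/(w _ _).
by lra.
Qed.

Let polygon_eq x p : path e x p -> uniq (x :: p) -> (2 <= size p)%N ->
  e (last x p) x -> w x (last x p) = len x p ->
  {in x :: p &, forall u v, u != v -> e u v}.
Proof.
move=> xp up sp lx wE; have [C [CG Cc VC Ce E]] := cycle_of_path xp up sp lx.
have le := cycle_le CG Cc; have := closing_le_max CG Ce; rewrite -/(w _ _) => le'.
have /(cycle_eq CG Cc)[_ cl] :
    2 * max_weight (weight G) C = total_weight (weight G) C.
  by apply/eqP; rewrite eq_le le /=; rewrite E; lra.
move=> u v up' vp' uv; apply/asboolP; apply: cl.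
- by rewrite VC; exists u.
- by rewrite VC; exists v.
- by move=> /g_inj/eqP; rewrite (negPf uv).
Qed.

Let label t := root_label G (g t).

Let label_injective : injective label.
Proof. by move=> u v E; apply: g_inj; apply: label_inj; rewrite ?inE. Qed.

Let label_root : label r0 = 0.
Proof. by rewrite /label /root_label g_root asboolT. Qed.

Let labelE t : t != r0 -> label t = w r0 t.
Proof.
move=> tr; rewrite /label /root_label asboolF /w ?g_root //.
by rewrite -g_root => /g_inj/eqP; rewrite (negPf tr).
Qed.

(** An edge at the root has positive weight because its label differs from the
label 0 of the root.  An edge [uv] of weight 0 elsewhere would give [u] and [v]
the same label, by the inequality of the triangle they form with the root. *)
Lemma edge_weight_gt0 u v : e u v -> 0 < w u v.
Proof.
have root_gt0 t : t != r0 -> 0 < w r0 t.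
  move=> tr; have er : e r0 t by rewrite e_sym e_root.
  rewrite lt_def w_ge0 // andbT -(labelE tr).
  by apply: contraNneq tr => E; apply/eqP/label_injective; rewrite E label_root.
move=> euv; have uv : u != v by apply: contraTneq euv => ->; rewrite e_irr.
have [ur|ur] := eqVneq u r0; first by rewrite ur root_gt0 // -ur eq_sym.
have [vr|vr] := eqVneq v r0; first by rewrite vr w_sym root_gt0.
rewrite lt_def w_ge0 // andbT; apply: contraNneq (uv) => w0.
apply/eqP/label_injective; rewrite !labelE //.
have tri a b : e a b -> a != b -> a != r0 -> b != r0 -> w r0 a <= w a b + w r0 b.
  move=> eab ab ar br.
  have pab : path e a [:: b; r0] by rewrite /= eab e_root.
  have uab : uniq [:: a; b; r0] by rewrite /= !inE negb_or ab ar br.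
  have era : e (last a [:: b; r0]) a by rewrite /= e_sym e_root.
  have := polygon_le pab uab isT era.
  by rewrite /path_length /= !big_cons big_nil addr0 (w_sym b) (w_sym a r0).
have := tri u v euv uv ur vr; rewrite w0 add0r => h1.
have evu : e v u by rewrite e_sym.
have vu : v != u by rewrite eq_sym.
have := tri v u evu vu vr ur; rewrite (w_sym v u) w0 add0r => h2.
by apply/eqP; rewrite eq_le h1 h2.
Qed.

Lemma realizable : FPC G.
Proof.
split=> //.
have [d1 [d2 [d1m d2m dE dN]]] :=
  two_metrics e_sym e_irr w_sym edge_weight_gt0 e_conn polygon_le polygon_eq.
pose d n := if odd n then d1 else d2.
have dm n : metric_axioms (d n) by rewrite /d; case: ifP.
have d_edge n u v : e u v -> d n u v = w u v.
  by move=> /dE; rewrite /d; case: ifP => _ [].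
have d_root n t : d n t r0 = label t.
  have [->|tr] := eqVneq t r0; first by rewrite label_root; case: (dm n).
  by rewrite d_edge ?e_root // labelE // w_sym.
pose X := blowup dm d_root.
exists X, (basepoint dm d_root), (scale R).
split; [exact: blowup_unbounded | exact: scale_scaling |].
pose c t : nat -> X := constant_at dm d_root t.
have cS t : Seq (basepoint dm d_root) (scale R) (c t) by exact: constant_Seq.
have r_gt0 := scale_gt0 R.
pose cls t := seq_class (basepoint dm d_root) (scale R) (c t).
have cls_inj t t' : cls t = cls t' -> t = t'.
  move=> /(seq_classP r_gt0 _ (cS t')).
  exact: constant_equiv_inj.
have cls_edge t t' : e t t' <->
    cluster_edges (basepoint dm d_root) (scale R) [set cls t; cls t'].
  split.
    move=> ett; apply/(cluster_edgesP r_gt0 (cS t) (cS t')); split.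
      move=> /(seq_classP r_gt0 _ (cS t'))/cls_inj E.
      by rewrite E e_irr in ett.
    apply/cvg_ex; exists (w t t').
    rewrite (_ : scaled _ _ _ = cst (w t t')); first exact: cvg_cst.
    by apply/funext => n; rewrite scaled_constant d_edge.
  move=> /(cluster_edgesP r_gt0 (cS t) (cS t')) [ntt ctt].
  apply: contraT => nett.
  have tt' : t != t' by apply/eqP => E; apply: ntt; rewrite E; exact: seq_equiv_refl.
  have /eqP[] := dN _ _ tt' nett.
  apply: cvg_alternating.
  rewrite (_ : (fun _ => _) = scaled (scale R) (c t) (c t')) //.
  by apply/funext => n; rewrite scaled_constant /d; case: ifP.
pose gi a := odflt r0 [pick t | `[< g t = a >]].
have gK t : gi (g t) = t.
  rewrite /gi; case: pickP => [t' /asboolP /g_inj //|/(_ t)].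
  by rewrite asboolT.
exists (fun a => cls (gi a)); split.
- rewrite g_range; split.
  + by move=> _ [t _ <-]; rewrite gK; exists (c t).
  + move=> _ _ /set_mem[t _ <-] /set_mem[t' _ <-]; rewrite !gK.
    by move=> /cls_inj ->.
  + move=> _ [x Sx <-]; have [t xt] := Seq_constant label_injective Sx.
    exists (g t); first by exists t.
    by rewrite gK; apply/esym/(seq_classP r_gt0 _ (cS t)).
- rewrite -g_root gK /cls.
  by have [] := seq_class_root r_gt0 (constant_root dm d_root).
- move=> u v; rewrite g_range => -[t _ <-] [t' _ <-]; rewrite !gK.
  rewrite [X in _ <-> X]/adjacent /= -cls_edge.
  by split=> /asboolP.
- move=> u v; rewrite g_range => -[t _ <-] [t' _ <-] /asboolP ett; rewrite !gK.
  apply: (cluster_weightE r_gt0 (cS t) (cS t')).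
  rewrite (_ : scaled _ _ _ = cst (w t t')); first exact: cvg_cst.
  by apply/funext => n; rewrite scaled_constant d_edge.
Qed.

End Backward.

Theorem theorem4p9 (R : realType) (A : Type) (G : wrgraph R A)
    (Gwr : is_wrgraph G) (Gfin : finite_set (vertices G)) :
  FPC G <->
  [/\ dominating G (wr_root G) /\ set_inj (vertices G) (root_label G),
      forall C : graph A, subgraph C G -> is_cycle C ->
        2 * max_weight (weight G) C <= total_weight (weight G) C
    & forall C : graph A, subgraph C G -> is_cycle C ->
        2 * max_weight (weight G) C = total_weight (weight G) C ->
        clique G (vertices C)].
Proof.
split.
  move=> [_ _ [X [p [r [_ [r_gt0 _] iso]]]]]; split.
  - exact: root_dominating_injective iso.
  - by move=> C CG /(cycle_conditions Gwr Gfin r_gt0 iso CG) [].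
  - by move=> C CG /(cycle_conditions Gwr Gfin r_gt0 iso CG) [].
move=> [[dom linj] cle ceq].
have [n] := (finite_setP _).1 Gfin.
move=> /card_set_bijP[f [fV fI fS]].
have /choice[h hP] (i : 'I_n) : exists a, vertices G a /\ f a = i.
  by have [a Ga fa] := fS i (ltn_ord i); exists a.
have hI : injective h.
  by move=> i j E; apply: val_inj; rewrite /= -(hP i).2 -(hP j).2 E.
have hV : vertices G = range h.
  apply/seteqP; split=> a; last by move=> [i _ <-]; case: (hP i).
  move=> Ga; exists (Ordinal (fV a Ga)) => //; have [Gh fh] := hP (Ordinal (fV a Ga)).
  by apply: fI; rewrite ?inE.
have [r0 _ hr] : range h (wr_root G) by rewrite -hV; case: Gwr.
exact: (realizable Gwr Gfin dom linj cle ceq hI hV hr).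
Qed.
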